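(* Let $u$ be an axisymmetric pattern on $\mathbb{S}^2$ of mass $m=0$ which is uniformly distributed and whose number of interfaces is greater than $4$. Then $u$ is not a critical point of $E_\gamma$ for any $\gamma>0$.
   Context: For $u\in BV(\mathbb{S}^2;\{\pm1\})$ with $\frac1{4\pi}\int_{\mathbb{S}^2}u\,d\mathcal{H}^2=m$ and $\gamma>0$, the energy is $$E_\gamma(u)=\frac12\int_{\mathbb{S}^2}|\nabla u|+\gamma\int_{\mathbb{S}^2}|\nabla v|^2\,d\mathcal{H}^2,$$ where $\int_{\mathbb{S}^2}|\nabla u|$ is the total variation of $u$, $v$ solves $-\Delta v=u-m$ on $\mathbb{S}^2$ ($\Delta$ is the Laplace--Beltrami operator of the unit sphere, and $v$ is unique up to an additive constant) and $\nabla$ is the gradient on $\mathbb{S}^2$. Functions on $\mathbb{S}^2$ depending only on the polar angle $\phi$ are regarded as functions of $z=\cos\phi\in[-1,1]$. An axisymmetric pattern with $n$ interfaces at $-1=z_0<z_1<\dots<z_n<z_{n+1}=1$ is the function $u$ with $u=(-1)^{k+1}$ on $[z_k,z_{k+1})$ for $k=0,\dots,n$; its mass is $m=\frac1{4\pi}\int_{\mathbb{S}^2}u\,d\mathcal{H}^2=\frac12\sum_{k=1}^{n+1}(-1)^k(z_k-z_{k-1})$. For such $u$, $v$ is also a function of $z$. The pattern is uniformly distributed (with respect to the $z$-coordinate) if the distance between consecutive interfaces is a fixed constant: there is $C$ with $z_{k+1}-z_k=C$ for all $k=1,\dots,n-1$. Such a pattern is a critical point of $E_\gamma$ if it satisfies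 the Euler--Lagrange equation: there is a constant $\lambda$ with $\kappa_g(z_k)+4\gamma v(z_k)=\lambda$ for all $k=1,\dots,n$, where $\kappa_g(z_k)$ is the signed geodesic curvature of the circle $\{z=z_k\}$ with respect to the normal pointing out of $\{u=1\}$, i.e. $\kappa_g(z_k)=(-1)^{k+1}z_k/\sqrt{1-z_k^2}$. *)

(* Defs.v *)
From Stdlib Require Import Reals.
From Coquelicot Require Import Coquelicot.
Open Scope R_scope.

Definition R3 : Type := (R * R * R)%type.
Definition pt (x y z : R) : R3 := (x, y, z).
Definition px (p : R3) : R := fst (fst p).
Definition py (p : R3) : R := snd (fst p).
Definition pz (p : R3) : R := snd p.

Definition sphere (p : R3) : Prop := px p ^ 2 + py p ^ 2 + pz p ^ 2 = 1.

(* Integral over the unit sphere against H^2. In the cylindrical coordinates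
   (z, theta) the area element of the sphere is exactly dz dtheta (Archimedes). *)
Definition sphere_int (f : R3 -> R) : R :=
  RInt (fun z =>
    RInt (fun t => f (pt (sqrt (1 - z ^ 2) * cos t) (sqrt (1 - z ^ 2) * sin t) z))
      0 (2 * PI))
    (-1) 1.

Definition Dx (f : R3 -> R) (p : R3) : R :=
  Derive (fun t => f (pt t (py p) (pz p))) (px p).
Definition Dy (f : R3 -> R) (p : R3) : R :=
  Derive (fun t => f (pt (px p) t (pz p))) (py p).
Definition Dz (f : R3 -> R) (p : R3) : R :=
  Derive (fun t => f (pt (px p) (py p) t)) (pz p).

Definition has_partials (f : R3 -> R) : Prop :=
  forall p : R3,
    ex_derive (fun t => f (pt t (py p) (pz p))) (px p) /\
    ex_derive (fun t => f (pt (px p) t (pz p))) (py p) /\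
    ex_derive (fun t => f (pt (px p) (py p) t)) (pz p).

Fixpoint class_C (k : nat) (f : R3 -> R) : Prop :=
  (forall p : R3, continuous f p) /\
  match k with
  | O => True
  | S k' => has_partials f /\
            class_C k' (Dx f) /\ class_C k' (Dy f) /\ class_C k' (Dz f)
  end.

Definition smooth (f : R3 -> R) : Prop := forall k : nat, class_C k f.

(* The extension f (p / |p|), constant along rays, of the restriction of f to
   the sphere. *)
Definition radial_ext (f : R3 -> R) (p : R3) : R :=
  let r := sqrt (px p ^ 2 + py p ^ 2 + pz p ^ 2) in
  f (pt (px p / r) (py p / r) (pz p / r)).

Definition laplacian (f : R3 -> R) (p : R3) : R :=
  Dx (Dx f) p + Dy (Dy f) p + Dz (Dz f) p.

(* Laplace-Beltrami operator of the unit sphere: on the sphere, it is the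
   Euclidean Laplacian of the extension that is constant along rays. Only its
   values at points of the sphere are meaningful. *)
Definition laplace_beltrami (f : R3 -> R) : R3 -> R := laplacian (radial_ext f).

(* V solves -Delta V = f on the sphere, in the sense of distributions since the
   right-hand sides of interest jump. Test functions on the sphere are the
   restrictions of smooth functions on R^3. For bounded f every solution has a
   continuous representative; continuity selects it, so that pointwise values
   of V make sense. *)
Definition solves_poisson (f V : R3 -> R) : Prop :=
  continuous_on sphere V /\
  forall phi : R3 -> R, smooth phi ->
    sphere_int (fun p => V p * - laplace_beltrami phi p) =
    sphere_int (fun p => f p * phi p).

(* Functions depending only on the polar angle are functions of z = cos(phi). *)
Definition axisym (w : R -> R) (p : R3) : R := w (pz p).

(* The interfaces are z 1, ..., z n; z 0 and z (n + 1) are the poles. *)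
Definition interfaces (n : nat) (z : nat -> R) : Prop :=
  z O = -1 /\ z (S n) = 1 /\ forall k : nat, (k <= n)%nat -> z k < z (S k).

(* The value of u at the north pole, a null set, is left unspecified. *)
Definition is_pattern (n : nat) (z : nat -> R) (u : R -> R) : Prop :=
  interfaces n z /\
  forall (k : nat) (t : R),
    (k <= n)%nat -> z k <= t < z (S k) -> u t = (-1) ^ (k + 1).

Definition mass (u : R -> R) : R := / (4 * PI) * sphere_int (axisym u).

Definition uniformly_distributed (n : nat) (z : nat -> R) : Prop :=
  exists C : R,
    forall k : nat, (1 <= k)%nat -> (k <= n - 1)%nat -> z (S k) - z k = C.

(* Signed geodesic curvature of the k-th interface with respect to the normal
   pointing out of {u = 1}, which points south for odd k and north for even k. *)
Definition geod_curv (z : nat -> R) (k : nat) : R :=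
  (-1) ^ (k + 1) * (z k / sqrt (1 - z k ^ 2)).

(* Euler-Lagrange equation. The potential v is unique up to an additive
   constant, which lambda absorbs, so the choice of v is immaterial. *)
Definition critical_point (gamma : R) (n : nat) (z : nat -> R) (u : R -> R) : Prop :=
  exists v : R -> R,
    solves_poisson (fun p => axisym u p - mass u) (axisym v) /\
    exists lambda : R,
      forall k : nat, (1 <= k)%nat -> (k <= n)%nat ->
        geod_curv z k + 4 * gamma * v (z k) = lambda.

(* Main.v *)
Require Import Defs.
From Stdlib Require Import Reals Lra Lia FunctionalExtensionality.
From Coquelicot Require Import Coquelicot.
Open Scope R_scope.

(** For functions of [z] the operator is
    [Delta eta = ((1 - z ^ 2) * eta')'], so a potential of a pattern [u] of
    mass zero satisfies [v' = - U / (1 - z ^ 2)] in the interior, where [U] is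
    the primitive of [u] that vanishes at both poles. Testing with powers of
    [z] is enough to extract this from the weak equation
    ([poisson_axisym_derive]), since a continuous function on [[-1, 1]] all of
    whose moments vanish is zero ([moments_zero]).

    Now look at the three last interfaces [a < b < c], at equal distances [C].
    Mass zero and more than 4 interfaces force [0 <= a]
    ([uniform_upper_interfaces]), so the signed curvatures at [a], [b], [c] alternate in
    sign, only the one at [a] being possibly zero. Subtracting Euler-Lagrange equations,
    [v c - v b] and [v a - v b] are then both nonzero with the same sign,
    whatever [gamma > 0] is. But [U] is a tent centred at [b], so both
    differences integrate one and the same affine profile, against the
    weights [1 / (1 - (b + t) ^ 2)] and [1 / (1 - (b - t) ^ 2)] for
    [0 <= t <= C]. The ratio of these weights is increasing because [b > 0].
    A profile with a single sign change cannot integrate to the two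
    required signs against weights ordered in this way
    ([mirror_potential_difference]). *)

Lemma continuous_of_ex_derive (f : R -> R) (x : R) : ex_derive f x -> continuous f x.
Proof. exact (ex_derive_continuous f x). Qed.

Lemma ex_RInt_everywhere_continuous (f : R -> R) (a b : R) :
  (forall x, continuous f x) -> ex_RInt f a b.
Proof. intros H; apply (@ex_RInt_continuous R_CompleteNormedModule); auto. Qed.

(** * The Laplace-Beltrami operator on functions of z *)

(** The family is closed under partial derivatives, so one induction on the
    order of differentiability suffices. *)
Lemma smooth_monomial (m : nat) (c : R) : smooth (axisym (fun t => c * t ^ m)).
Proof.
intros k; revert m c; induction k as [|k IH]; intros m c.
- split; [|exact I].
  intros p. unfold axisym.
  apply (continuous_comp pz (fun t => c * t ^ m)).
  + apply continuous_snd.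
  + apply continuous_of_ex_derive. auto_derive; easy.
- split; [|split; [|split; [|split]]].
  + intros p. unfold axisym.
    apply (continuous_comp pz (fun t => c * t ^ m)).
    * apply continuous_snd.
    * apply continuous_of_ex_derive. auto_derive; easy.
  + intros p. unfold axisym; simpl. repeat split; auto_derive; easy.
  + replace (Defs.Dx (axisym (fun t => c * t ^ m)))
      with (axisym (fun t => 0 * t ^ 0));
      [apply IH|].
    apply functional_extensionality; intros p.
    unfold Defs.Dx, axisym; simpl. rewrite Derive_const; ring.
  + replace (Defs.Dy (axisym (fun t => c * t ^ m)))
      with (axisym (fun t => 0 * t ^ 0));
      [apply IH|].
    apply functional_extensionality; intros p.
    unfold Dy, axisym; simpl. rewrite Derive_const; ring.
  + replace (Defs.Dz (axisym (fun t => c * t ^ m)))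
      with (axisym (fun t => (c * INR m) * t ^ pred m));
      [apply IH|].
    apply functional_extensionality; intros p.
    unfold Dz, axisym; simpl. symmetry. apply is_derive_unique.
    auto_derive; [easy|ring].
Qed.

Lemma Derive2_comp (eta eta1 eta2 q q1 : R -> R) (q2 x : R) :
  (forall t, is_derive eta t (eta1 t)) ->
  (forall t, is_derive eta1 t (eta2 t)) ->
  locally x (fun t => is_derive q t (q1 t)) ->
  is_derive q1 x q2 ->
  Derive (fun t => Derive (fun s => eta (q s)) t) x
  = eta2 (q x) * q1 x ^ 2 + eta1 (q x) * q2.
Proof.
intros H1 H2 Hq Hq1.
rewrite (Derive_ext_loc _ (fun t => q1 t * eta1 (q t))).
2:{ revert Hq; apply filter_imp; intros t Ht.
    apply is_derive_unique.
    apply (is_derive_comp eta q t (eta1 (q t)) (q1 t)); auto. }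
apply is_derive_unique.
pose proof (locally_singleton _ _ Hq) as Hqx.
pose proof (is_derive_comp eta1 q x _ _ (H2 (q x)) Hqx) as Hc.
pose proof (is_derive_mult q1 (fun t => eta1 (q t)) x _ _ Hq1 Hc Rmult_comm) as Hm.
replace (_ + _) with (plus (mult q2 (eta1 (q x))) (mult (q1 x) (scal (q1 x) (eta2 (q x)))));
  [exact Hm|].
unfold plus, mult, scal; simpl; unfold mult; simpl; ring.
Qed.

Lemma locally_radius_pos (x d : R) : 0 < x ^ 2 + d -> locally x (fun t => 0 < t ^ 2 + d).
Proof.
intros H.
apply (continuous_comp (fun t => t) (fun t => t ^ 2 + d) x).
- apply continuous_id.
- apply continuous_of_ex_derive; auto_derive; easy.
- apply open_gt; exact H.
Qed.

(** The function [eta (z / |p|)] along a line through a point of the sphere,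
    orthogonal to the axis here and parallel to it in the next lemma; [d] is
    the squared distance from the origin to the line. *)
Lemma Derive2_transverse (eta eta1 eta2 : R -> R) (c d x : R) :
  (forall t, is_derive eta t (eta1 t)) ->
  (forall t, is_derive eta1 t (eta2 t)) ->
  x ^ 2 + d = 1 ->
  Derive (fun t => Derive (fun s => eta (c / sqrt (s ^ 2 + d))) t) x
  = eta2 c * (c * x) ^ 2 - eta1 c * (c * (1 - 3 * x ^ 2)).
Proof.
intros H1 H2 Hx.
assert (Hr : sqrt (x ^ 2 + d) = 1) by (rewrite Hx; apply sqrt_1).
rewrite (Derive2_comp eta eta1 eta2 (fun t => c / sqrt (t ^ 2 + d))
   (fun t => - c * t / sqrt (t ^ 2 + d) ^ 3) (- c * (1 - 3 * x ^ 2))); auto.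
- rewrite Hr. replace (c / 1) with c by field. field.
- apply (filter_imp (fun t => 0 < t ^ 2 + d)); [|apply locally_radius_pos; lra].
  intros t Ht. pose proof (sqrt_lt_R0 _ Ht) as Hp.
  auto_derive; replace (t * (t * 1) + d) with (t ^ 2 + d) by ring.
  + repeat split; lra.
  + field; lra.
- auto_derive; replace (x * (x * 1) + d) with (x ^ 2 + d) by ring; rewrite Hr.
  + repeat split; lra.
  + field.
Qed.

Lemma Derive2_axial (eta eta1 eta2 : R -> R) (d x : R) :
  (forall t, is_derive eta t (eta1 t)) ->
  (forall t, is_derive eta1 t (eta2 t)) ->
  x ^ 2 + d = 1 ->
  Derive (fun t => Derive (fun s => eta (s / sqrt (s ^ 2 + d))) t) x
  = eta2 x * d ^ 2 - eta1 x * (3 * x * d).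
Proof.
intros H1 H2 Hx.
assert (Hr : sqrt (x ^ 2 + d) = 1) by (rewrite Hx; apply sqrt_1).
rewrite (Derive2_comp eta eta1 eta2 (fun t => t / sqrt (t ^ 2 + d))
   (fun t => d / sqrt (t ^ 2 + d) ^ 3) (- 3 * x * d)); auto.
- rewrite Hr. replace (x / 1) with x by field. field.
- apply (filter_imp (fun t => 0 < t ^ 2 + d)); [|apply locally_radius_pos; lra].
  intros t Ht. pose proof (sqrt_lt_R0 _ Ht) as Hp.
  pose proof (sqrt_sqrt _ (Rlt_le _ _ Ht)) as Hq.
  auto_derive; replace (t * (t * 1) + d) with (t ^ 2 + d) by ring.
  + repeat split; lra.
  + set (r := sqrt (t ^ 2 + d)) in *.
    replace d with (r * r - t ^ 2) by lra. field; lra.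
- auto_derive; replace (x * (x * 1) + d) with (x ^ 2 + d) by ring; rewrite Hr.
  + repeat split; lra.
  + field.
Qed.

(** The squared gradient of [z / |p|] on the sphere is [1 - z ^ 2], which
    multiplies [eta'']; its Euclidean Laplacian there is [- 2 * z], because
    [z] is a spherical harmonic of degree 1 (eigenvalue 2), and it multiplies
    [eta']. *)
Lemma laplace_beltrami_axisym (eta eta1 eta2 : R -> R) (p : R3) :
  (forall t, is_derive eta t (eta1 t)) ->
  (forall t, is_derive eta1 t (eta2 t)) ->
  sphere p ->
  laplace_beltrami (axisym eta) p
  = (1 - pz p ^ 2) * eta2 (pz p) - 2 * pz p * eta1 (pz p).
Proof.
intros H1 H2; destruct p as [[x y] z]; unfold sphere; cbn [px py pz fst snd]; intros Hs.
unfold laplace_beltrami, laplacian, Defs.Dx, Dy, Dz, radial_ext, axisym.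
cbn [px py pz pt fst snd].
rewrite (Derive_ext _ (fun t => Derive (fun s => eta (z / sqrt (s ^ 2 + (y ^ 2 + z ^ 2)))) t) x).
2:{ intros t; apply Derive_ext; intros s. do 3 f_equal; ring. }
rewrite (Derive_ext _ (fun t => Derive (fun s => eta (z / sqrt (s ^ 2 + (x ^ 2 + z ^ 2)))) t) y).
2:{ intros t; apply Derive_ext; intros s. do 3 f_equal; ring. }
rewrite (Derive_ext _ (fun t => Derive (fun s => eta (s / sqrt (s ^ 2 + (x ^ 2 + y ^ 2)))) t) z).
2:{ intros t; apply Derive_ext; intros s. do 3 f_equal; ring. }
rewrite (Derive2_transverse eta eta1 eta2) by (auto; lra).
rewrite (Derive2_transverse eta eta1 eta2) by (auto; lra).
rewrite (Derive2_axial eta eta1 eta2) by (auto; lra).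
transitivity (eta2 z * (z ^ 2 * (x ^ 2 + y ^ 2) + (x ^ 2 + y ^ 2) ^ 2)
  - eta1 z * (z * (2 - 3 * (x ^ 2 + y ^ 2)) + 3 * z * (x ^ 2 + y ^ 2))); [ring|].
replace (x ^ 2 + y ^ 2) with (1 - z ^ 2) by lra. ring.
Qed.

(** * Continuous functions with vanishing moments *)

(** Vanishing moments are used only through powers of a quadratic. Such a power
    gains one factor at a time, so it suffices to carry an arbitrary extra
    monomial through the induction, which avoids expanding the power. *)
Lemma peak_integral_zero (B : R -> R) (x0 d : R) (N : nat) :
  (forall x, continuous B x) ->
  (forall j : nat, RInt (fun t => B t * t ^ j) (-1) 1 = 0) ->
  RInt (fun t => B t * (1 + (d ^ 2 - (t - x0) ^ 2) / 4) ^ N) (-1) 1 = 0.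
Proof.
intros HB HM.
assert (HC : forall N j x, continuous (fun t => B t * t ^ j * (1 + (d ^ 2 - (t - x0) ^ 2) / 4) ^ N) x).
{ intros N' j x.
  apply (continuous_mult (fun t => B t * t ^ j)).
  - apply (continuous_mult B); auto.
    apply continuous_of_ex_derive; auto_derive; easy.
  - apply continuous_of_ex_derive; auto_derive; easy. }
enough (H : forall j, RInt (fun t => B t * t ^ j * (1 + (d ^ 2 - (t - x0) ^ 2) / 4) ^ N) (-1) 1 = 0).
{ etransitivity; [|exact (H O)]. apply RInt_ext; intros x _; simpl; ring. }
induction N as [|N IH]; intros j.
- rewrite <- (HM j). apply RInt_ext; intros x _; simpl; ring.
- set (F := fun j t => B t * t ^ j * (1 + (d ^ 2 - (t - x0) ^ 2) / 4) ^ N) in *.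
  assert (HF : forall j, is_RInt (F j) (-1) 1 0).
  { intros i. rewrite <- (IH i). apply (RInt_correct (F i)). apply ex_RInt_everywhere_continuous. apply HC. }
  apply is_RInt_unique.
  apply (is_RInt_ext (fun t => plus (scal (1 + (d ^ 2 - x0 ^ 2) / 4) (F j t))
     (plus (scal (x0 / 2) (F (S j) t)) (scal (- / 4) (F (S (S j)) t))))).
  + intros t _. unfold plus, scal; simpl; unfold mult; simpl. unfold F; simpl. field.
  + replace 0 with (plus (scal (1 + (d ^ 2 - x0 ^ 2) / 4) 0)
     (plus (scal (x0 / 2) 0) (scal (- / 4) 0)))
     by (unfold plus, scal; simpl; unfold mult; simpl; ring).
    apply @is_RInt_plus; [|apply @is_RInt_plus]; apply @is_RInt_scal; apply HF.
Qed.

Lemma is_RInt_peak (e d x0 N : R) :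
  is_RInt (fun t => e * (1 + N * ((d ^ 2 - (t - x0) ^ 2) / 4))) (x0 - d) (x0 + d)
    (e * (2 * d + N * d ^ 3 / 3)).
Proof.
replace (e * (2 * d + N * d ^ 3 / 3)) with
  (minus ((fun t => e * (t + N / 4 * (d ^ 2 * (t - x0) - (t - x0) ^ 3 / 3))) (x0 + d))
         ((fun t => e * (t + N / 4 * (d ^ 2 * (t - x0) - (t - x0) ^ 3 / 3))) (x0 - d)))
  by (unfold minus, plus, opp; simpl; field).
apply (is_RInt_derive (fun t => e * (t + N / 4 * (d ^ 2 * (t - x0) - (t - x0) ^ 3 / 3)))).
- intros t _. auto_derive; [easy|field].
- intros t _. apply continuous_of_ex_derive; auto_derive; easy.
Qed.

(** A substitute for Weierstrass approximation. If [B x0 > 0], the polynomial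
    [p = 1 + (d ^ 2 - (t - x0) ^ 2) / 4] exceeds 1 exactly for [|t - x0| < d]
    and lies in [[0, 1]] on the rest of [[-1, 1]]. Against [p ^ N], the part of
    the integral of [B] near [x0] grows at least linearly in [N] while the rest
    stays bounded, so the integral cannot vanish for all [N]. *)
Lemma moments_nonpos (B : R -> R) :
  (forall x, continuous B x) ->
  (forall j : nat, RInt (fun t => B t * t ^ j) (-1) 1 = 0) ->
  forall x0, -1 < x0 < 1 -> B x0 <= 0.
Proof.
intros HB HM x0 Hx0.
destruct (Rle_lt_dec (B x0) 0) as [|Hpos]; [assumption|exfalso].
set (e := B x0 / 2).
assert (He : 0 < e) by (unfold e; lra).
assert (Hloc : locally x0 (fun t => e < B t)).
{ apply (HB x0). apply open_gt. unfold e; lra. }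
destruct Hloc as [d0 Hd0].
set (d := Rmin (d0 / 2) (Rmin (1 - x0) (x0 + 1))).
pose proof (cond_pos d0) as Hd0p.
assert (Hd : 0 < d) by (unfold d; repeat apply Rmin_glb_lt; lra).
assert (Hd1 : d < d0).
{ apply Rle_lt_trans with (d0 / 2); [apply Rmin_l|lra]. }
assert (Hd2 : d <= 1 - x0).
{ eapply Rle_trans; [apply Rmin_r|apply Rmin_l]. }
assert (Hd3 : d <= x0 + 1).
{ eapply Rle_trans; [apply Rmin_r|apply Rmin_r]. }
assert (HBe : forall t, x0 - d <= t <= x0 + d -> e < B t).
{ intros t Ht. apply Hd0. unfold ball; simpl; unfold AbsRing_ball, abs, minus, plus, opp; simpl.
  apply Rabs_lt_between; lra. }
destruct (continuity_ab_maj (fun t => Rabs (B t)) (-1) 1) as [tm [Htm _]]; [lra| |].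
{ intros c _. apply continuity_pt_filterlim.
  apply (continuous_comp B Rabs); [apply HB|apply continuous_Rabs]. }
set (M := Rabs (B tm)) in *.
(* With this N the peak, at least e * N * d ^ 3 / 3, outweighs the remainder,
   which is at least - 2 * M because [-1, 1] has length 2. *)
destruct (INR_unbounded (6 * M / (e * d ^ 3))) as [N HN].
assert (Hed : 0 < e * d ^ 3) by (apply Rmult_lt_0_compat; [|apply pow_lt]; assumption).
assert (HN' : 2 * M < e * (INR N * d ^ 3 / 3)).
{ apply (Rmult_gt_compat_r (e * d ^ 3)) in HN; [|assumption].
  unfold Rdiv in HN. rewrite Rmult_assoc, Rinv_l in HN; [|lra]. lra. }
pose (p := fun t => 1 + (d ^ 2 - (t - x0) ^ 2) / 4).
pose proof (peak_integral_zero B x0 d N HB HM) as H0.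
pose (F := fun t => B t * p t ^ N).
fold (p) in H0. change (RInt F (-1) 1 = 0) in H0.
assert (HF : forall a b, ex_RInt F a b).
{ intros a b. apply ex_RInt_everywhere_continuous. intros x. apply (continuous_mult B); auto.
  apply continuous_of_ex_derive; unfold p; auto_derive; easy. }
rewrite <- (RInt_Chasles F (-1) (x0 - d) 1) in H0 by apply HF.
rewrite <- (RInt_Chasles F (x0 - d) (x0 + d) 1) in H0 by apply HF.
unfold plus in H0; simpl in H0.
assert (Hout : forall a b, a <= b -> -1 <= a -> b <= 1 ->
   (forall t, a < t < b -> d <= Rabs (t - x0)) -> - M * (b - a) <= RInt F a b).
{ intros a b Hab Ha Hb Hdist.
  replace (- M * (b - a)) with (RInt (fun _ => - M) a b)
    by (rewrite RInt_const; unfold scal; simpl; unfold mult; simpl; ring).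
  apply RInt_le; [assumption|apply ex_RInt_const|apply HF|].
  intros t Ht. specialize (Hdist t Ht).
  assert (Hp : 0 <= p t <= 1).
  { unfold p. assert (d ^ 2 <= (t - x0) ^ 2).
    { rewrite <- (pow2_abs (t - x0)). apply pow_incr; lra. }
    assert ((t - x0) ^ 2 <= 4) by nra.
    assert (0 <= d ^ 2) by apply pow2_ge_0. lra. }
  assert (HpN : 0 <= p t ^ N <= 1).
  { split; [apply pow_le; lra|].
    rewrite <- (pow1 N). apply pow_incr; lra. }
  assert (HtM : Rabs (B t) <= M) by (apply (Htm t); lra).
  apply Rabs_le_between in HtM. unfold F. nra. }
assert (Hl : - M * (x0 - d - -1) <= RInt F (-1) (x0 - d)).
{ apply Hout; try lra. intros t Ht. rewrite Rabs_left; lra. }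
assert (Hr : - M * (1 - (x0 + d)) <= RInt F (x0 + d) 1).
{ apply Hout; try lra. intros t Ht. rewrite Rabs_right; lra. }
assert (Hm : e * (2 * d + INR N * d ^ 3 / 3) <= RInt F (x0 - d) (x0 + d)).
{ rewrite <- (is_RInt_unique _ _ _ _ (is_RInt_peak e d x0 (INR N))).
  apply RInt_le; [lra|eexists; apply is_RInt_peak|apply HF|].
  intros t Ht. unfold F.
  assert (Hq : 0 <= (d ^ 2 - (t - x0) ^ 2) / 4) by nra.
  assert (HBt : e < B t) by (apply HBe; lra).
  (* Bernoulli's inequality [poly] is about positive increments; the increment
     vanishes at the two ends of the interval. *)
  assert (Hbern : 1 + INR N * ((d ^ 2 - (t - x0) ^ 2) / 4) <= p t ^ N).
  { destruct (Req_dec ((d ^ 2 - (t - x0) ^ 2) / 4) 0) as [Hz|Hz].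
    - unfold p; rewrite Hz. rewrite Rplus_0_r, pow1. lra.
    - apply poly. lra. }
  assert (0 <= INR N) by apply pos_INR.
  apply Rmult_le_compat; try lra.
  assert (0 <= INR N * ((d ^ 2 - (t - x0) ^ 2) / 4)) by (apply Rmult_le_pos; assumption). lra. }
assert (HMp : 0 <= M) by apply Rabs_pos.
assert (0 < e * d) by (apply Rmult_lt_0_compat; assumption).
nra.
Qed.

Lemma moments_zero (B : R -> R) :
  (forall x, continuous B x) ->
  (forall j : nat, RInt (fun t => B t * t ^ j) (-1) 1 = 0) ->
  forall x0, -1 < x0 < 1 -> B x0 = 0.
Proof.
intros HB HM x0 Hx0.
apply Rle_antisym; [apply moments_nonpos; auto|].
enough (- B x0 <= 0) by lra.
apply (moments_nonpos (fun t => - B t)); auto.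
- intros x; apply (continuous_opp B); auto.
- intros j. rewrite <- Ropp_0, <- (HM j).
  rewrite <- (RInt_opp (fun t => B t * t ^ j)).
  + apply RInt_ext; intros; unfold opp; simpl; ring.
  + apply ex_RInt_everywhere_continuous. intros x. apply (continuous_mult B); auto.
    apply continuous_of_ex_derive; auto_derive; easy.
Qed.

(** * The Poisson equation for functions of z *)

Lemma continuous_Rmin (f : R -> R) (c x : R) :
  continuous f x -> continuous (fun t => Rmin (f t) c) x.
Proof.
intros Hf.
apply (continuous_ext (fun t => / 2 * ((f t + c) - Rabs (f t - c)))).
{ intros t. unfold Rmin; destruct (Rle_dec (f t) c).
  - rewrite Rabs_left1; lra.
  - rewrite Rabs_right; lra. }
apply (continuous_scal_r (/ 2) (fun t => (f t + c) - Rabs (f t - c))).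
apply (continuous_minus (fun t => f t + c)).
- apply (continuous_plus f); [exact Hf|apply continuous_const].
- apply (continuous_Rabs_comp (fun t => f t - c)).
  apply (continuous_minus f); [exact Hf|apply continuous_const].
Qed.

(** Retraction of the line onto [[-1, 1]]: composing with it turns a profile
    that is only meaningful for [z] in [[-1, 1]] into a function continuous on
    all of [R]. *)
Definition clamp (t : R) : R := - Rmin (- Rmin t 1) 1.

Lemma clamp_bounds (t : R) : -1 <= clamp t <= 1.
Proof. unfold clamp, Rmin; repeat destruct Rle_dec; lra. Qed.

Lemma clamp_id (t : R) : -1 <= t <= 1 -> clamp t = t.
Proof. intros; unfold clamp, Rmin; repeat destruct Rle_dec; lra. Qed.

Lemma continuous_clamp (x : R) : continuous clamp x.
Proof.
apply (continuous_opp (fun t => Rmin (- Rmin t 1) 1)).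
apply (continuous_Rmin (fun t => - Rmin t 1)).
apply (continuous_opp (fun t => Rmin t 1)).
apply (continuous_Rmin (fun t => t)). apply continuous_id.
Qed.

Lemma continuous_pair (T U V : UniformSpace) (f : T -> U) (g : T -> V) (x : T) :
  continuous f x -> continuous g x -> continuous (fun t => (f t, g t)) x.
Proof.
intros Hf Hg.
apply (continuous_comp_2 f g (fun a b => (a, b))); auto.
apply (continuous_ext (fun w : U * V => w)); [now intros []|apply continuous_id].
Qed.

(** The profile is the restriction of the function to a meridian. *)
Lemma continuous_meridian_profile (v : R -> R) :
  continuous_on sphere (axisym v) -> forall x, continuous (fun t => v (clamp t)) x.
Proof.
intros Hv x.
pose (c := fun t => pt (sqrt (1 - clamp t ^ 2)) 0 (clamp t)).
assert (Hc : forall t, sphere (c t)).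
{ intros t. unfold sphere, c. cbn [px py pz pt fst snd].
  pose proof (clamp_bounds t). rewrite pow2_sqrt; nra. }
apply (filterlim_comp _ _ _ c (axisym v) _ (within sphere (locally (c x)))).
2: apply (Hv (c x)), Hc.
assert (Hcc : continuous c x).
{ apply (continuous_pair R_UniformSpace (prod_UniformSpace R_UniformSpace R_UniformSpace) R_UniformSpace
    (fun t => (sqrt (1 - clamp t ^ 2), 0)) clamp); [|apply continuous_clamp].
  apply (continuous_pair _ _ _ (fun t => sqrt (1 - clamp t ^ 2)) (fun _ => 0));
    [|apply continuous_const].
  apply (continuous_sqrt_comp (fun t => 1 - clamp t ^ 2)).
  apply (continuous_comp clamp (fun y => 1 - y ^ 2)); [apply continuous_clamp|].
  apply continuous_of_ex_derive; auto_derive; easy. }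
intros P HP. specialize (Hcc (fun p => sphere p -> P p) HP). revert Hcc.
unfold filtermap. apply filter_imp. auto.
Qed.

(** [f] is known on the sphere only, which is all the integral sees. *)
Lemma sphere_int_axisym (f : R3 -> R) (h : R -> R) :
  (forall p, sphere p -> f p = h (pz p)) ->
  ex_RInt h (-1) 1 ->
  sphere_int f = 2 * PI * RInt h (-1) 1.
Proof.
intros Hf Hh. unfold sphere_int.
transitivity (RInt (fun y => scal (2 * PI) (h y)) (-1) 1);
  [|apply (RInt_scal h (-1) 1 (2 * PI) Hh)].
apply RInt_ext. rewrite Rmin_left, Rmax_right by lra. intros x Hx.
rewrite (RInt_ext _ (fun _ => h x)).
- rewrite RInt_const. f_equal. ring.
- intros t _. rewrite Hf; [reflexivity|].
  unfold sphere. cbn [px py pz pt fst snd].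
  rewrite !Rpow_mult_distr, pow2_sqrt by nra.
  pose proof (sin2_cos2 t) as H. unfold Rsqr in H. nra.
Qed.

(** [U' = u] on [[-1, 1]] with [U 1 = 0]: the boundary term at [1] is
    dropped for every [eta], and so is the one at [-1]. This is integration by
    parts without differentiating [U], which has corners at the jumps of
    [u]. *)
Definition weak_primitive (u U : R -> R) : Prop :=
  forall eta eta1 : R -> R,
    (forall t, is_derive eta t (eta1 t)) -> (forall t, continuous eta1 t) ->
    is_RInt (fun t => u t * eta t + U t * eta1 t) (-1) 1 0.

(** Testing the Poisson equation with [eta = c * z ^ m] and integrating the
    right-hand side by parts; the integrand is written with [eta''] and
    [eta'] made explicit. *)
Lemma poisson_monomial (u U v : R -> R) (m : nat) (c : R) :
  (forall x, continuous U x) -> weak_primitive u U ->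
  solves_poisson (axisym u) (axisym v) ->
  RInt (fun t => (1 - t ^ 2) * v (clamp t) * (c * INR m * INR (pred m) * t ^ pred (pred m))
     - (U t + 2 * t * v (clamp t)) * (c * INR m * t ^ pred m)) (-1) 1 = 0.
Proof.
intros HU HuU [Hv Hpois].
pose proof (continuous_meridian_profile v Hv) as Hvc.
pose (eta := fun t => c * t ^ m).
pose (eta1 := fun t => c * INR m * t ^ pred m).
pose (eta2 := fun t => c * INR m * INR (pred m) * t ^ pred (pred m)).
assert (D1 : forall t, is_derive eta t (eta1 t)).
{ intros t; unfold eta, eta1; auto_derive; [easy|ring]. }
assert (D2 : forall t, is_derive eta1 t (eta2 t)).
{ intros t; unfold eta1, eta2; auto_derive; [easy|ring]. }
assert (C1 : forall t, continuous eta1 t).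
{ intros t; apply continuous_of_ex_derive; eexists; apply D2. }
assert (C2 : forall t, continuous eta2 t).
{ intros t; apply continuous_of_ex_derive; unfold eta2; auto_derive; easy. }
pose (h := fun t => v (clamp t) * - ((1 - t ^ 2) * eta2 t - 2 * t * eta1 t)).
assert (Hh : ex_RInt h (-1) 1).
{ apply ex_RInt_everywhere_continuous; intros t. apply (continuous_mult (fun t => v (clamp t))); auto.
  apply (continuous_opp (fun t => (1 - t ^ 2) * eta2 t - 2 * t * eta1 t)).
  apply (continuous_minus (fun t => (1 - t ^ 2) * eta2 t)).
  - apply (continuous_mult (fun t => 1 - t ^ 2)); auto.
    apply continuous_of_ex_derive; auto_derive; easy.
  - apply (continuous_mult (fun t => 2 * t)); auto.
    apply continuous_of_ex_derive; auto_derive; easy. }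
assert (HUe : ex_RInt (fun t => U t * eta1 t) (-1) 1).
{ apply ex_RInt_everywhere_continuous; intros t; apply (continuous_mult U); auto. }
apply (RInt_correct (fun t => U t * eta1 t)) in HUe.
assert (Hue : is_RInt (fun t => u t * eta t) (-1) 1 (- RInt (fun t => U t * eta1 t) (-1) 1)).
{ replace (- _) with (minus 0 (RInt (fun t => U t * eta1 t) (-1) 1))
    by (unfold minus, plus, opp; simpl; ring).
  eapply is_RInt_ext; [|apply @is_RInt_minus; [apply (HuU eta eta1 D1 C1)|exact HUe]].
  intros t _. unfold minus, plus, opp; simpl; ring. }
specialize (Hpois (axisym eta) (smooth_monomial m c)).
rewrite (sphere_int_axisym _ h) in Hpois; [| |exact Hh].
2:{ intros p Hp. rewrite (laplace_beltrami_axisym eta eta1 eta2 p D1 D2 Hp).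
    unfold h, axisym. rewrite clamp_id; [reflexivity|].
    unfold sphere in Hp. nra. }
rewrite (sphere_int_axisym _ (fun t => u t * eta t)) in Hpois;
  [|reflexivity|eexists; exact Hue].
rewrite (is_RInt_unique _ _ _ _ Hue) in Hpois.
apply Rmult_eq_reg_l in Hpois; [|pose proof PI_RGT_0; lra].
apply (RInt_correct h) in Hh. rewrite Hpois in Hh.
apply is_RInt_unique.
replace 0 with (opp (plus (- RInt (fun t => U t * eta1 t) (-1) 1) (RInt (fun t => U t * eta1 t) (-1) 1)))
  by (unfold plus, opp; simpl; ring).
eapply is_RInt_ext; [|apply @is_RInt_opp, @is_RInt_plus; [exact Hh|exact HUe]].
intros t _. unfold plus, opp, h, eta1, eta2; simpl. ring.
Qed.

(** The equation is [((1 - z ^ 2) * v')' = - u], so formally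
    [(1 - z ^ 2) * v' = - U]. Dividing by the weight [1 - z ^ 2] before the
    regularity of [v] is known would create singular integrals at the poles.
    Instead the first-order equation is integrated once more: with
    [J' = U + 2 * z * v] and [J (-1) = 0], it says that
    [B = (1 - z ^ 2) * v + J] is constant, hence zero by its value at [-1]. All
    terms of [B] are continuous on [[-1, 1]], and the weak equation says that
    [B] is orthogonal to every monomial. So [B = 0], which expresses [v] by a
    differentiable formula in the interior. *)
Lemma poisson_axisym_derive (u U v : R -> R) :
  (forall x, continuous U x) -> weak_primitive u U ->
  solves_poisson (axisym u) (axisym v) ->
  forall t, -1 < t < 1 -> is_derive v t (- U t / (1 - t ^ 2)).
Proof.
intros HU HuU Hpois.
pose proof (continuous_meridian_profile v (proj1 Hpois)) as Hvc.
pose (vc := fun t => v (clamp t)). fold vc in Hvc.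
pose (j := fun t => U t + 2 * t * vc t).
assert (Hj : forall t, continuous j t).
{ intros t. apply (continuous_plus U); auto.
  apply (continuous_mult (fun t => 2 * t)); auto.
  apply continuous_of_ex_derive; auto_derive; easy. }
pose (J := fun t => RInt j (-1) t).
assert (DJ : forall t, is_derive J t (j t)).
{ intros t. apply (is_derive_RInt j J (-1) t); auto.
  apply filter_forall. intros b. apply (RInt_correct j). apply ex_RInt_everywhere_continuous, Hj. }
assert (CJ : forall t, continuous J t).
{ intros t; apply continuous_of_ex_derive; eexists; apply DJ. }
assert (J0 : J (-1) = 0) by apply @RInt_point.
(* This is the weak equation for the test function eta = - z. *)
assert (J1 : J 1 = 0).
{ pose proof (poisson_monomial u U v 1 (-1) HU HuU Hpois) as H.
  rewrite <- H. apply RInt_ext. intros t _. unfold j, vc. simpl; ring. }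
pose (B := fun t => (1 - t ^ 2) * vc t + J t).
assert (HB : forall t, continuous B t).
{ intros t. apply (continuous_plus (fun t => (1 - t ^ 2) * vc t)); auto.
  apply (continuous_mult (fun t => 1 - t ^ 2)); auto.
  apply continuous_of_ex_derive; auto_derive; easy. }
assert (HB0 : forall t, -1 < t < 1 -> B t = 0).
{ apply moments_zero; [exact HB|]. intros k.
  assert (Hk1 : INR (k + 1) <> 0) by (apply not_0_INR; lia).
  assert (Hk2 : INR (k + 2) <> 0) by (apply not_0_INR; lia).
  (* The test function is eta = z ^ (k + 2) / ((k + 1) (k + 2)), chosen so that
     eta'' = z ^ k. *)
  pose (eta1 := fun t => / INR (k + 1) * t ^ (k + 1)).
  assert (D1 : forall t, is_derive eta1 t (t ^ k)).
  { intros t. unfold eta1. auto_derive; [easy|].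
    replace (pred (k + 1)) with k by lia. field; exact Hk1. }
  pose (w := fun t => (1 - t ^ 2) * vc t * t ^ k - j t * eta1 t).
  assert (Hw : RInt w (-1) 1 = 0).
  { rewrite <- (poisson_monomial u U v (k + 2) (/ (INR (k + 1) * INR (k + 2))) HU HuU Hpois).
    apply RInt_ext. intros t _. unfold w, j, vc, eta1.
    match goal with |- ?a = ?b => change (@eq R a b) end.
    replace (pred (k + 2)) with (k + 1)%nat by lia.
    replace (pred (k + 1)) with k by lia. field; auto. }
  assert (Hwc : ex_RInt w (-1) 1).
  { apply ex_RInt_everywhere_continuous. intros t.
    apply (continuous_minus (fun t => (1 - t ^ 2) * vc t * t ^ k)).
    - apply (continuous_mult (fun t => (1 - t ^ 2) * vc t)).
      + apply (continuous_mult (fun t => 1 - t ^ 2)); auto.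
        apply continuous_of_ex_derive; auto_derive; easy.
      + apply continuous_of_ex_derive; auto_derive; easy.
    - apply (continuous_mult j); auto.
      apply continuous_of_ex_derive; eexists; apply D1. }
  apply (RInt_correct w) in Hwc. rewrite Hw in Hwc.
  assert (HJ : is_RInt (fun t => j t * eta1 t + J t * t ^ k) (-1) 1 0).
  { replace 0 with (J 1 * eta1 1 - J (-1) * eta1 (-1)) by (rewrite J0, J1; ring).
    apply (is_RInt_scal_derive J eta1 j (fun t => t ^ k)); auto.
    intros t _. apply continuous_of_ex_derive; auto_derive; easy. }
  apply is_RInt_unique.
  replace 0 with (plus 0 0) by (unfold plus; simpl; ring).
  eapply is_RInt_ext; [|apply @is_RInt_plus; [exact Hwc|exact HJ]].
  intros t _. unfold plus, w, B; simpl. ring. }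
intros t Ht.
assert (Hne : 1 - t ^ 2 <> 0) by nra.
apply (is_derive_ext_loc (fun s => - J s / (1 - s ^ 2))).
{ assert (Hloc : locally t (fun s => -1 < s < 1)).
  { apply (open_and (fun s => -1 < s) (fun s => s < 1)); [apply open_gt|apply open_lt|exact Ht]. }
  revert Hloc; apply filter_imp. intros s Hs.
  assert (Hnes : 1 - s ^ 2 <> 0) by nra.
  pose proof (HB0 s Hs) as H. unfold B, vc in H. rewrite clamp_id in H by lra.
  apply (Rmult_eq_reg_r (1 - s ^ 2)); [|exact Hnes].
  unfold Rdiv; rewrite Rmult_assoc, Rinv_l by exact Hnes. lra. }
pose proof (HB0 t Ht) as H. unfold B in H.
replace (- U t / (1 - t ^ 2)) with
  (- (j t * (1 - t ^ 2) + 2 * t * J t) / (1 - t ^ 2) ^ 2).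
2:{ replace (J t) with (- ((1 - t ^ 2) * vc t)) by lra. unfold j. field. exact Hne. }
pose proof (DJ t) as DJt.
auto_derive.
- repeat split; [eexists; exact DJt|]. replace (t * (t * 1)) with (t ^ 2) by ring. exact Hne.
- replace (Derive _ t) with (j t) by (symmetry; apply is_derive_unique; exact DJt).
  field. exact Hne.
Qed.

(** * The primitive of a pattern *)

(** The term of index [k] is the integral of [(-1) ^ (k + 1)] over the part of
    [[z k, z (k + 1)]] below [t]. The formula makes sense and is continuous for
    every real [t], unlike the integral of [u], which is arbitrary outside
    [[-1, 1)]. *)
Fixpoint pattern_primitive (z : nat -> R) (m : nat) (t : R) : R :=
  match m with
  | O => 0
  | S k => pattern_primitive z k t + (-1) ^ (k + 1) * (Rmin t (z (S k)) - Rmin t (z k))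
  end.

Lemma continuous_pattern_primitive (z : nat -> R) (m : nat) (x : R) : continuous (pattern_primitive z m) x.
Proof.
induction m as [|k IH]; simpl; [apply continuous_const|].
apply (continuous_plus (pattern_primitive z k)); [exact IH|].
apply (continuous_scal_r ((-1) ^ (k + 1)) (fun t => Rmin t (z (S k)) - Rmin t (z k))).
apply (continuous_minus (fun t => Rmin t (z (S k))));
  apply (continuous_Rmin (fun t => t)), continuous_id.
Qed.

Lemma interfaces_mono (n : nat) (z : nat -> R) (j k : nat) :
  interfaces n z -> (j <= k)%nat -> (k <= S n)%nat -> z j <= z k.
Proof.
intros [_ [_ H]] Hjk; induction Hjk as [|k Hjk IH]; intros Hk; [lra|].
specialize (H k ltac:(lia)). specialize (IH ltac:(lia)). lra.
Qed.

Lemma pattern_primitive_below (n : nat) (z : nat -> R) (k m : nat) (t : R) :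
  interfaces n z -> (k <= m)%nat -> (m <= S n)%nat -> t <= z k ->
  pattern_primitive z m t = pattern_primitive z k t.
Proof.
intros Hz Hkm; induction Hkm as [|m Hkm IH]; intros Hm Ht; [reflexivity|simpl].
pose proof (interfaces_mono n z k m Hz ltac:(lia) ltac:(lia)).
pose proof (interfaces_mono n z m (S m) Hz ltac:(lia) ltac:(lia)).
rewrite IH by (auto; lia). rewrite !Rmin_left by lra. ring.
Qed.

Lemma pattern_primitive_above (n : nat) (z : nat -> R) (m : nat) (t : R) :
  interfaces n z -> (m <= S n)%nat -> z m <= t -> pattern_primitive z m t =
  pattern_primitive z m (z m).
Proof.
intros Hz; revert t; induction m as [|m IH]; intros t Hm Ht; [reflexivity|simpl].
pose proof (interfaces_mono n z m (S m) Hz ltac:(lia) ltac:(lia)).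
rewrite (IH t) by (lia || lra). rewrite (IH (z (S m))) by (lia || lra).
rewrite !Rmin_right by lra. reflexivity.
Qed.

Lemma pattern_primitive_step (n : nat) (z : nat -> R) (k : nat) (t : R) :
  interfaces n z -> (k <= n)%nat -> z k <= t <= z (S k) ->
  pattern_primitive z (S n) t = pattern_primitive z (S n) (z k) + (-1) ^ (k + 1) * (t - z k).
Proof.
intros Hz Hk Ht.
rewrite (pattern_primitive_below n z (S k) (S n) t) by (auto; lia || lra).
rewrite (pattern_primitive_below n z k (S n) (z k)) by (auto; lia || lra).
simpl. rewrite (pattern_primitive_above n z k t) by (auto; lia || lra).
rewrite (Rmin_left t), (Rmin_right t) by lra. reflexivity.
Qed.

Lemma pattern_primitive_south (n : nat) (z : nat -> R) :
  interfaces n z -> pattern_primitive z (S n) (-1) = 0.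
Proof.
intros Hz. rewrite (pattern_primitive_below n z 0 (S n)); auto; [lia|]. destruct Hz as [-> _]; lra.
Qed.

(** On each piece the primitive is affine, so classical integration by parts
    applies and the boundary terms telescope. *)
Lemma pattern_by_parts (n : nat) (z : nat -> R) (u eta eta1 : R -> R) (k : nat) :
  is_pattern n z u ->
  (forall t, is_derive eta t (eta1 t)) -> (forall t, continuous eta1 t) ->
  (k <= S n)%nat ->
  is_RInt (fun t => u t * eta t + pattern_primitive z (S n) t * eta1 t) (-1) (z k)
    (pattern_primitive z (S n) (z k) * eta (z k)).
Proof.
intros [Hz Hu] D1 C1.
set (U := pattern_primitive z (S n)).
induction k as [|k IH]; intros Hk.
- destruct Hz as [H0 Hz']. rewrite H0. unfold U.
  rewrite pattern_primitive_south by (split; auto). rewrite Rmult_0_l. apply @is_RInt_point.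
- specialize (IH ltac:(lia)).
  pose proof (proj2 (proj2 Hz) k ltac:(lia)) as Hlt.
  pose proof (pattern_primitive_step n z k) as Hstep. fold U in Hstep.
  replace (U (z (S k)) * eta (z (S k))) with
    (plus (U (z k) * eta (z k)) (U (z (S k)) * eta (z (S k)) - U (z k) * eta (z k)))
    by (unfold plus; simpl; ring).
  apply (@is_RInt_Chasles R_NormedModule _ (-1) (z k) (z (S k))); [exact IH|].
  set (s := (-1) ^ (k + 1)) in *.
  rewrite (Hstep (z (S k))) by (auto; lia || lra).
  apply (is_RInt_ext (fun t => s * eta t + (U (z k) + s * (t - z k)) * eta1 t)).
  { rewrite Rmin_left, Rmax_right by lra. intros t Ht.
    rewrite (Hstep t) by (auto; lia || lra).
    rewrite (Hu k t) by (lia || lra). reflexivity. }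
  replace (U (z k) * eta (z k)) with ((U (z k) + s * (z k - z k)) * eta (z k)) by ring.
  apply (is_RInt_scal_derive (fun t => U (z k) + s * (t - z k)) eta (fun _ => s) eta1); auto.
  + intros t _. auto_derive; [easy|ring].
  + intros t _. apply continuous_const.
Qed.

Lemma mass_pattern (n : nat) (z : nat -> R) (u : R -> R) :
  is_pattern n z u -> mass u = pattern_primitive z (S n) 1 / 2.
Proof.
intros Hu. unfold mass.
assert (H : is_RInt u (-1) 1 (pattern_primitive z (S n) 1)).
{ pose proof (pattern_by_parts n z u (fun _ => 1) (fun _ => 0) (S n) Hu) as H.
  rewrite (proj1 (proj2 (proj1 Hu))), Rmult_1_r in H.
  eapply is_RInt_ext; [|apply H].
  - intros t _; simpl; ring.
  - intros t; auto_derive; easy.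
  - intros t; apply continuous_const.
  - lia. }
rewrite (sphere_int_axisym _ u); [|reflexivity|eexists; exact H].
rewrite (is_RInt_unique _ _ _ _ H). field. apply PI_neq0.
Qed.

Lemma pattern_weak_primitive (n : nat) (z : nat -> R) (u : R -> R) :
  is_pattern n z u -> mass u = 0 -> weak_primitive u (pattern_primitive z (S n)).
Proof.
intros Hu Hm eta eta1 D1 C1.
rewrite (mass_pattern n z u Hu) in Hm.
pose proof (pattern_by_parts n z u eta eta1 (S n) Hu D1 C1 (le_n _)) as H.
rewrite (proj1 (proj2 (proj1 Hu))) in H.
replace (pattern_primitive z (S n) 1) with 0 in H by lra. rewrite Rmult_0_l in H. exact H.
Qed.

Lemma uniform_position (n : nat) (z : nat -> R) (C : R) :
  (forall k, (1 <= k)%nat -> (k <= n - 1)%nat -> z (S k) - z k = C) ->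
  forall k, (S k <= n)%nat -> z (S k) = z 1%nat + INR k * C.
Proof.
intros H k; induction k as [|k IH]; intros Hk; [simpl; ring|].
specialize (H (S k) ltac:(lia) ltac:(lia)). specialize (IH ltac:(lia)).
rewrite S_INR. lra.
Qed.

(** Equal spacing makes the primitive take only two values on the interfaces:
    it goes up by [C] and back down by [C] alternately. *)
Lemma pattern_primitive_uniform (n : nat) (z : nat -> R) (C : R) :
  interfaces n z ->
  (forall k, (1 <= k)%nat -> (k <= n - 1)%nat -> z (S k) - z k = C) ->
  forall k, (S k <= n)%nat ->
  pattern_primitive z (S n) (z (S k)) = - (z 1%nat + 1) + C * (1 - (-1) ^ k) / 2.
Proof.
intros Hz H k; induction k as [|k IH]; intros Hk.
- pose proof (proj2 (proj2 Hz) O ltac:(lia)).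
  rewrite (pattern_primitive_step n z 0) by (auto; lia || lra).
  rewrite (proj1 Hz), pattern_primitive_south by auto. simpl. field.
- pose proof (proj2 (proj2 Hz) (S k) ltac:(lia)).
  rewrite (pattern_primitive_step n z (S k)) by (auto; lia || lra).
  rewrite IH by lia. rewrite (H (S k)) by lia.
  rewrite Nat.add_1_r. simpl. field.
Qed.

(** Mass zero fixes the position of the pattern. For odd [n] the two polar
    caps have equal height, so the pattern is symmetric and
    [z (n - 2) = (n - 5) * C / 2]. For even [n] the heights of the caps add up
    to [C], so [n * C = 2] and [z (n - 2) > 1 - 3 * C = (n - 6) / n]. Both
    bounds are nonnegative exactly because there are more than 4
    interfaces. *)
Lemma uniform_upper_interfaces (n : nat) (z : nat -> R) (C : R) :
  interfaces n z ->
  (forall k, (1 <= k)%nat -> (k <= n - 1)%nat -> z (S k) - z k = C) ->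
  pattern_primitive z (S n) 1 = 0 -> (4 < n)%nat -> 0 <= z (n - 2)%nat.
Proof.
intros Hz H H0 Hn.
destruct n as [|m]; [lia|].
pose proof (pattern_primitive_uniform (S m) z C Hz H m (le_n _)) as HU.
pose proof (uniform_position (S m) z C H m (le_n _)) as Hpos.
pose proof (uniform_position (S m) z C H (m - 2) ltac:(lia)) as Hpos2.
replace (S (m - 2)) with (S m - 2)%nat in Hpos2 by lia.
rewrite minus_INR in Hpos2 by lia. simpl (INR 2) in Hpos2.
pose proof (proj1 (proj2 Hz)) as H1.
pose proof (proj1 Hz) as Hz0.
pose proof (proj2 (proj2 Hz) 0%nat ltac:(lia)) as Hz01.
pose proof (proj2 (proj2 Hz) (S m) ltac:(lia)) as Hlast.
pose proof (proj2 (proj2 Hz) 1%nat ltac:(lia)) as Hz12.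
specialize (H 1%nat ltac:(lia) ltac:(lia)).
pose proof (pattern_primitive_step (S m) z (S m) 1 Hz (le_n _) ltac:(lra)) as Hstep.
rewrite H0, HU, Nat.add_1_r in Hstep.
change ((-1) ^ S (S m)) with (-1 * (-1 * (-1) ^ m)) in Hstep.
assert (Hm : 4 <= INR m) by (replace 4 with (INR 4) by (simpl; lra); apply le_INR; lia).
destruct (Nat.Even_or_Odd m) as [[q ->]|[q ->]].
- rewrite pow_1_even in Hstep. nra.
- rewrite Nat.add_1_r in *. rewrite pow_1_odd in Hstep.
  assert (Hm5 : 5 <= INR (S (2 * q))).
  { replace 5 with (INR 5) by (simpl; lra); apply le_INR; lia. }
  nra.
Qed.

(** * Comparison of the two sides of an interface *)

(** This is the quotient [w (b + t) / w (b - t)] for the weight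
    [w x = 1 / (1 - x ^ 2)], and it equals
    [1 + 4 * b * t / (1 - (b + t) ^ 2)]. *)
Lemma weight_ratio_mono (b t t' : R) :
  0 < b -> 0 <= t <= t' -> b + t' < 1 ->
  (1 - (b - t) ^ 2) / (1 - (b + t) ^ 2) <= (1 - (b - t') ^ 2) / (1 - (b + t') ^ 2).
Proof.
intros Hb Ht Ht'.
assert (H1 : 0 < 1 - (b + t) ^ 2) by nra.
assert (H2 : 0 < 1 - (b + t') ^ 2) by nra.
replace ((1 - (b - t) ^ 2) / (1 - (b + t) ^ 2)) with (1 + 4 * b * (t / (1 - (b + t) ^ 2)))
  by (field; lra).
replace ((1 - (b - t') ^ 2) / (1 - (b + t') ^ 2)) with (1 + 4 * b * (t' / (1 - (b + t') ^ 2)))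
  by (field; lra).
apply Rplus_le_compat_l, Rmult_le_compat_l; [lra|].
apply Rmult_le_compat; try lra.
- left; apply Rinv_0_lt_compat; assumption.
- apply Rinv_le_contravar; [assumption|nra].
Qed.

(** [U] is even about [b] and affine on each side, so the potential
    differences from [b] to its two neighbours are integrals of the same
    profile [P = s * U b - t], against the weights [w (b + t)] and [w (b - t)].
    [P] changes sign at most once, from positive to negative, and the ratio of
    the weights increases. Taking for [r] its value at the sign change makes
    the combined integrand [P * (r * w (b - t) - w (b + t))] nonnegative
    everywhere. So the two differences cannot both have the sign of [- s]. *)
Lemma mirror_potential_difference (U v : R -> R) (b C s : R) :
  (forall t, -1 < t < 1 -> is_derive v t (- U t / (1 - t ^ 2))) ->
  s * s = 1 -> 0 < b -> 0 < C -> b + C < 1 ->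
  (forall t, 0 <= t <= C -> U (b + t) = U b - s * t /\ U (b - t) = U b - s * t) ->
  exists r, 0 < r /\ 0 <= s * ((v (b + C) - v b) + r * (v (b - C) - v b)).
Proof.
intros Dv Hs Hb HC HbC HU.
pose (ratio := fun t => (1 - (b - t) ^ 2) / (1 - (b + t) ^ 2)).
(* The zero of P, moved to the nearest endpoint when P has no sign change. *)
pose (t0 := Rmax 0 (Rmin C (s * U b))).
assert (Ht0 : 0 <= t0 <= C).
{ unfold t0, Rmax, Rmin; repeat destruct Rle_dec; lra. }
exists (ratio t0).
assert (Hsign : forall t, 0 <= t <= C -> 0 <= (s * U b - t) * (ratio t0 - ratio t)).
{ intros t Ht.
  destruct (Rle_lt_dec t t0) as [Hle|Hlt].
  - pose proof (weight_ratio_mono b t t0 Hb ltac:(lra) ltac:(lra)) as Hr.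
    fold (ratio t) (ratio t0) in Hr.
    destruct (Req_dec t t0) as [->|Hne]; [lra|].
    apply Rmult_le_pos; [|lra].
    unfold t0, Rmax, Rmin in Hle, Hne; repeat destruct Rle_dec; lra.
  - pose proof (weight_ratio_mono b t0 t Hb ltac:(lra) ltac:(lra)) as Hr.
    fold (ratio t) (ratio t0) in Hr.
    assert (s * U b - t <= 0); [|nra].
    unfold t0, Rmax, Rmin in Hlt; repeat destruct Rle_dec; lra. }
assert (Hpos : 0 < ratio t0).
{ apply Rdiv_lt_0_compat; nra. }
split; [exact Hpos|].
pose (K := fun t => s * (v (b + t) + ratio t0 * v (b - t))).
pose (dK := fun t => s * (- U (b + t) / (1 - (b + t) ^ 2)
                          + ratio t0 * (U (b - t) / (1 - (b - t) ^ 2)))).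
assert (DK : forall t, 0 <= t <= C -> is_derive K t (dK t)).
{ intros t Ht.
  pose proof (Dv (b + t) ltac:(lra)) as Dp.
  pose proof (Dv (b - t) ltac:(lra)) as Dm.
  unfold K. auto_derive.
  - split; [|split]; [eexists; exact Dp|eexists; exact Dm|easy].
  - replace (Derive _ (b + t)) with (- U (b + t) / (1 - (b + t) ^ 2))
      by (symmetry; apply is_derive_unique; exact Dp).
    replace (Derive _ (b + - t)) with (- U (b - t) / (1 - (b - t) ^ 2))
      by (symmetry; apply is_derive_unique; exact Dm).
    unfold dK, Rdiv. ring. }
assert (HdK : forall t, 0 <= t <= C -> 0 <= dK t).
{ intros t Ht. destruct (HU t Ht) as [Hp Hm].
  assert (Hwm : 0 < 1 - (b - t) ^ 2) by nra.
  assert (Hwp : 0 < 1 - (b + t) ^ 2) by nra.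
  replace (dK t) with ((s * U b - t) * (ratio t0 - ratio t) / (1 - (b - t) ^ 2)).
  - apply Rmult_le_pos; [apply Hsign; exact Ht|left; apply Rinv_0_lt_compat; exact Hwm].
  - unfold dK. rewrite Hp, Hm.
    transitivity ((s * U b - s * s * t) * (ratio t0 - ratio t) / (1 - (b - t) ^ 2));
      [rewrite Hs; field; lra|].
    unfold ratio at 2. field. split; lra. }
destruct (MVT_gen K 0 C dK) as [c [Hc HK]].
- rewrite Rmin_left, Rmax_right by lra. intros t Ht. apply DK; lra.
- rewrite Rmin_left, Rmax_right by lra. intros t Ht.
  apply continuity_pt_filterlim, continuous_of_ex_derive. eexists; apply DK; exact Ht.
- rewrite Rmin_left, Rmax_right in Hc by lra.
  specialize (HdK c Hc). unfold K in HK.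
  rewrite Rplus_0_r, Rminus_0_r in HK. nra.
Qed.

Theorem proposition5p4 (n : nat) (z : nat -> R) (u : R -> R)
    (hu : is_pattern n z u) (hmass : mass u = 0)
    (hunif : uniformly_distributed n z) (hn : (4 < n)%nat) :
  forall gamma : R, 0 < gamma -> ~ critical_point gamma n z u.
Proof.
intros gamma Hgamma [v [Hpois [lambda HEL]]].
destruct hunif as [C HC].
rewrite hmass in Hpois.
replace (fun p => axisym u p - 0) with (axisym u) in Hpois
  by (apply functional_extensionality; intros p; ring).
pose proof (pattern_weak_primitive n z u hu hmass) as HuU.
pose proof (poisson_axisym_derive u _ v (continuous_pattern_primitive z (S n)) HuU Hpois) as Dv.
pose proof hu as [Hz _].
assert (HU1 : pattern_primitive z (S n) 1 = 0).
{ pose proof (mass_pattern n z u hu). lra. }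
pose proof (uniform_upper_interfaces n z C Hz HC HU1 hn) as Ha.
destruct n as [|[|k]]; try lia.
replace (S (S k) - 2)%nat with k in Ha by lia.
set (U := pattern_primitive z (S (S (S k)))) in *.
pose proof (HC k ltac:(lia) ltac:(lia)) as Hab.
pose proof (HC (S k) ltac:(lia) ltac:(lia)) as Hbc.
pose proof (proj2 (proj2 Hz) k ltac:(lia)) as Hab0.
pose proof (proj2 (proj2 Hz) (S (S k)) ltac:(lia)) as Hlast.
rewrite (proj1 (proj2 Hz)) in Hlast.
set (s := (-1) ^ (k + 1)).
assert (Hs1 : (-1) ^ (S k + 1) = - s) by (unfold s; simpl; ring).
assert (Hs2 : (-1) ^ (S (S k) + 1) = s) by (unfold s; simpl; ring).
assert (Hss : s * s = 1).
{ unfold s. rewrite <- Rpow_mult_distr. replace (-1 * -1) with 1 by ring. apply pow1. }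
(* Index k + 1 is the middle interface b = z (n - 1); s is the value of u just
   south of it. *)
destruct (mirror_potential_difference U v (z (S k)) C s Dv Hss)
  as [r [Hr Hdiff]]; try lra.
{ intros t Ht. split.
  - unfold U. rewrite (pattern_primitive_step _ z (S k)) by (auto; lia || lra). rewrite Hs1. ring.
  - unfold U. rewrite (pattern_primitive_step _ z k (z (S k) - t)) by (auto; lia || lra).
    rewrite (pattern_primitive_step _ z k (z (S k))) by (auto; lia || lra). fold s. ring. }
replace (z (S k) + C) with (z (S (S k))) in Hdiff by lra.
replace (z (S k) - C) with (z k) in Hdiff by lra.
assert (Hg : forall x, 0 <= x < 1 -> 0 <= x / sqrt (1 - x ^ 2)).
{ intros x Hx. apply Rdiv_le_0_compat; [lra|apply sqrt_lt_R0; nra]. }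
assert (Hgb : 0 < z (S k) / sqrt (1 - z (S k) ^ 2)).
{ apply Rdiv_lt_0_compat; [lra|apply sqrt_lt_R0; nra]. }
pose proof (Hg (z k) ltac:(lra)) as Hga.
pose proof (Hg (z (S (S k))) ltac:(lra)) as Hgc.
pose proof (HEL k ltac:(lia) ltac:(lia)) as Ea.
pose proof (HEL (S k) ltac:(lia) ltac:(lia)) as Eb.
pose proof (HEL (S (S k)) ltac:(lia) ltac:(lia)) as Ec.
unfold geod_curv in Ea, Eb, Ec. rewrite Hs1 in Eb. rewrite Hs2 in Ec. fold s in Ea.
set (ga := z k / _) in *. set (gb := z (S k) / _) in *. set (gc := z (S (S k)) / _) in *.
assert (E : 4 * gamma * (s * ((v (z (S (S k))) - v (z (S k))) + r * (v (z k) - v (z (S k)))))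
  = - ((gb + gc) + r * (ga + gb))).
{ transitivity (s * ((4 * gamma * v (z (S (S k))) - 4 * gamma * v (z (S k)))
      + r * (4 * gamma * v (z k) - 4 * gamma * v (z (S k))))); [ring|].
  replace (4 * gamma * v (z (S (S k)))) with (lambda - s * gc) by lra.
  replace (4 * gamma * v (z (S k))) with (lambda + s * gb) by lra.
  replace (4 * gamma * v (z k)) with (lambda - s * ga) by lra.
  transitivity (- (s * s) * ((gb + gc) + r * (ga + gb))); [ring|rewrite Hss; ring]. }
apply (Rmult_le_compat_l (4 * gamma)) in Hdiff; [|lra].
rewrite E in Hdiff.
assert (0 <= r * (ga + gb)) by (apply Rmult_le_pos; lra).
lra.
Qed.
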